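(* Let $\mathbb{F}$ be $\mathbb{R}$ or $\mathbb{C}$. Take $d\ge3$ and $v_{kj}\in\mathbb{F}^n$ vectors with $\|v_{kj}\|=1$. Let $T\in S^d(\mathbb{F}^n)$ be a symmetric tensor with decomposition $T=\sum_{k=1}^r\sigma_k\bigotimes_{j=1}^dv_{kj}$, $\sigma_k\in\mathbb{F}$. Assume that there is an index $1\le j_*\le d$ such that $v_{kj_*}\perp v_{k'j_*}$ for all $k\ne k'$. If $r$ is the minimal integer for which such a decomposition exists, then $v_{kj}=v_{k1}$ up to multiplication by a complex phase factor, for all $1\le j\le d$ and $1\le k\le r$. Moreover, if there are two distinct indices $1\le j_*,j_{**}\le d$ with $v_{kj_*}\perp v_{k'j_*}$ and also $v_{kj_{**}}\perp v_{k'j_{**}}$ for all $k\ne k'$, then any such decomposition has minimal $r$, which also equals the rank of $T$.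
   Context: $S^d(\mathbb{F}^n)$ denotes the tensors in $\mathbb{F}^{n\times\cdots\times n}$ ($d$ factors) invariant under all permutations of the $d$ indices (symmetric tensors). $\bigotimes_{j=1}^dv_j$ has entries $\prod_jv_j(i_j)$. Orthogonality and norm of vectors are with respect to $\langle x,y\rangle=\sum_ix(i)\overline{y(i)}$. The rank of $T$ is the least number of tensors of the form $v_1\otimes\cdots\otimes v_d$ over $\mathbb{F}$ whose linear combination is $T$.
   Formalization: In the ''Moreover'' part all coefficients σ_k are assumed nonzero; without this the claim fails (e.g. T = 0, r = 1, σ_1 = 0), since a term with zero coefficient can always be dropped. *)

(* Defs.v *)
From HB Require Import structures.
From mathcomp Require Import all_boot all_order all_algebra all_fingroup.
From mathcomp Require Import reals.
From mathcomp.real_closed Require Import complex.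

Set Implicit Arguments.
Unset Strict Implicit.
Unset Printing Implicit Defensive.

Import Order.TTheory GRing.Theory Num.Theory.
Local Open Scope ring_scope.

Variant base_field := RealNumbers | ComplexNumbers.

Definition field_of (R : realType) (K : base_field) : numFieldType :=
  match K with
  | RealNumbers => R : numFieldType
  | ComplexNumbers => R[i] : numFieldType
  end.

Definition conj_of (R : realType) (K : base_field) :
    field_of R K -> field_of R K :=
  match K return field_of R K -> field_of R K with
  | RealNumbers => fun x : R => x
  | ComplexNumbers => fun x : R[i] => conjc x
  end.

Definition re_of (R : realType) (K : base_field) : field_of R K -> R :=
  match K return field_of R K -> R with
  | RealNumbers => fun x : R => x
  | ComplexNumbers => fun x : R[i] => complex.Re x
  end.

Arguments conj_of {R K} _.
Arguments re_of {R K} _.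

Section Vectors.
Variables (R : realType) (K : base_field) (n : nat).
Local Notation F := (field_of R K).

Definition inner (x y : 'cV[F]_n) : F := \sum_(i < n) x i 0 * conj_of (y i 0).

(* [inner x x] is a nonnegative real, so taking its real part only changes its
   type, from F to R. *)
Definition vnorm (x : 'cV[F]_n) : R := Num.sqrt (re_of (inner x x)).

End Vectors.

Section Tensors.
Variables (F : fieldType) (n d : nat).

(* F^(n x ... x n) with d factors; the codomain F^o provides the F-module
   structure. *)
Definition tensor := {ffun {ffun 'I_d -> 'I_n} -> F^o}.

Definition symmetric_tensor (T : tensor) :=
  forall (s : 'S_d) (i : {ffun 'I_d -> 'I_n}), T [ffun j => i (s j)] = T i.

Definition tprod (v : 'I_d -> 'cV[F]_n) : tensor :=
  [ffun i : {ffun 'I_d -> 'I_n} => \prod_(j < d) v j (i j) 0].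

Definition tcomb r (sigma : 'I_r -> F) (v : 'I_r -> 'I_d -> 'cV[F]_n) : tensor :=
  \sum_(k < r) sigma k *: tprod (v k).

End Tensors.

Definition least (P : nat -> Prop) (r : nat) :=
  P r /\ forall r', P r' -> (r <= r')%N.

Definition has_rank (F : fieldType) (n d : nat) (T : tensor F n d) : nat -> Prop :=
  least (fun r => exists (sigma : 'I_r -> F) (v : 'I_r -> 'I_d -> 'cV[F]_n),
                    T = tcomb sigma v).

Section Decompositions.
Variables (R : realType) (K : base_field) (n d : nat).
Local Notation F := (field_of R K).

Definition unit_decomposition (T : tensor F n d) r
    (sigma : 'I_r -> F) (v : 'I_r -> 'I_d -> 'cV[F]_n) :=
  (forall k j, vnorm (v k j) = 1) /\ T = tcomb sigma v.

Definition orthogonal_at r (v : 'I_r -> 'I_d -> 'cV[F]_n) (j : 'I_d) :=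
  forall k k', k <> k' -> inner (v k j) (v k' j) = 0.

Definition orthogonal_length (T : tensor F n d) (r : nat) :=
  exists (sigma : 'I_r -> F) (v : 'I_r -> 'I_d -> 'cV[F]_n),
    unit_decomposition T sigma v /\ exists j, orthogonal_at v j.

End Decompositions.

(* The index written 1 in the 1-based convention. *)
Definition first_index d (hd : (3 <= d)%N) : 'I_d :=
  Ordinal (leq_trans (isT : (1 <= 3)%N) hd).

(* Main.v *)
(** Everything is read off the multilinear form x |-> <T, x_1 (x) ... (x) x_d>,
    which is symmetric since T is.  Write e_k for the orthonormal vectors
    v_(k,j_* ).  Contracting T with e_k at j_* gives the tensor
    sigma_k (x)_(j != j_* ) v_kj, which is symmetric, so the v_kj with j != j_*
    are proportional to one vector u_k.  Contracting T with e_k and e_m at two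
    positions, in both orders, gives
      sigma_k <u_k, e_m> u_k^(d-2) = sigma_m <u_m, e_k> u_m^(d-2)
    up to phases; if <u_k, e_m> != 0 for some k != m, then u_k and u_m are
    parallel (as d >= 3), and the terms k and m merge into one without losing
    orthogonality at j_*, against minimality.  Hence u_k is orthogonal to e_m
    for all m != k, and one more use of symmetry makes u_k parallel to e_k.

    For the second part, contracting with v_(k,j_* ) at j_* and with v_mj at
    all other j gives the matrix diag(sigma) of rank r, which factors through
    the length of any decomposition of T. *)

Require Import Defs.
From mathcomp Require Import all_boot all_order all_algebra all_fingroup.
From mathcomp Require Import reals.
From mathcomp.real_closed Require Import complex.

Set Implicit Arguments.
Unset Strict Implicit.
Unset Printing Implicit Defensive.

Import Order.TTheory GRing.Theory Num.Theory.
Local Open Scope ring_scope.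

(** * Inner product and norm, uniformly over the two base fields *)

Section Inner.
Variables (R : realType) (K : base_field) (n : nat).
Local Notation F := (field_of R K).
Implicit Types (a b c : F) (x y z : 'cV[F]_n).

Lemma conj_ofD a b : conj_of (a + b) = conj_of a + conj_of b.
Proof. by case: K a b => a b //=; apply: rmorphD. Qed.

Lemma conj_ofM a b : conj_of (a * b) = conj_of a * conj_of b.
Proof. by case: K a b => a b //=; apply: rmorphM. Qed.

Lemma conj_of0 : conj_of (0 : F) = 0.
Proof. by case: K => //; apply: (rmorph0 (@conjc R)). Qed.

Lemma conj_of1 : conj_of (1 : F) = 1.
Proof. by case: K => //; apply: (rmorph1 (@conjc R)). Qed.

Lemma mul_conj_of a : a * conj_of a = `|a| ^+ 2.
Proof.
case: K a => a /=; last by rewrite sqr_normc.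
by rewrite -expr2 real_normK ?num_real.
Qed.

Lemma innerDl x y z : inner (x + y) z = inner x z + inner y z.
Proof. by rewrite /inner -big_split; apply: eq_bigr => i _; rewrite mxE mulrDl. Qed.

Lemma innerZl a x z : inner (a *: x) z = a * inner x z.
Proof. by rewrite /inner mulr_sumr; apply: eq_bigr => i _; rewrite mxE mulrA. Qed.

Lemma innerDr x y z : inner z (x + y) = inner z x + inner z y.
Proof.
by rewrite /inner -big_split; apply: eq_bigr => i _; rewrite mxE conj_ofD mulrDr.
Qed.

Lemma innerZr a x z : inner z (a *: x) = conj_of a * inner z x.
Proof.
by rewrite /inner mulr_sumr; apply: eq_bigr => i _; rewrite mxE conj_ofM mulrCA.
Qed.

(** Testing against the standard basis recovers the coordinates. Later, vector identities come from
    scalar ones with a free argument in one slot. *)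
Lemma inner_inj x y : inner x =1 inner y -> x = y.
Proof.
move=> xy; apply/colP => i.
have E z : inner z (delta_mx i 0) = z i 0.
  rewrite /inner (bigD1 i) //= mxE !eqxx conj_of1 mulr1 big1 ?addr0 // => j ji.
  by rewrite mxE (negPf ji) conj_of0 mulr0.
by rewrite -E xy E.
Qed.

Lemma inner_ge0 x : 0 <= inner x x.
Proof. by apply: sumr_ge0 => i _; rewrite mul_conj_of exprn_ge0. Qed.

Lemma vnorm_eq1 x : (vnorm x == 1) = (inner x x == 1).
Proof.
have sqrt_eq1 (u : R) : (Num.sqrt u == 1) = (u == 1).
  have [u0|u0] := lerP 0 u; first by rewrite -[1 in LHS]sqrtr1 eqr_sqrt.
  rewrite ler0_sqrtr ?ltW // eq_sym oner_eq0; apply/esym/negbTE.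
  by rewrite lt_eqF // (lt_trans u0).
rewrite /vnorm sqrt_eq1; have := inner_ge0 x; move: (inner x x).
case: K => //= -[u u'] /=; rewrite lecE /= => /andP[/eqP-> _].
by rewrite eq_complex /= eqxx andbT.
Qed.

Lemma vnorm_normalize x : inner x x != 0 ->
  exists2 c : F, c != 0 & vnorm (c *: x) = 1.
Proof.
move=> x0; suff [c cE] : exists c : F, `|c| ^+ 2 * inner x x = 1.
  exists c.
    apply: contra_eq_neq cE => ->.
    by rewrite normr0 expr0n mul0r eq_sym oner_neq0.
  by apply/eqP; rewrite vnorm_eq1 innerZl innerZr mulrA mul_conj_of cE.
have := inner_ge0 x; move: (inner x x) x0.
case: K => /= u u0 u_ge0.
  by exists (Num.sqrt u)^-1; rewrite real_normK ?num_real // exprVn sqr_sqrtr ?mulVf.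
exists (sqrtc u)^-1; rewrite normfV exprVn -normrX sqr_sqrtc ger0_norm //.
by rewrite mulVf.
Qed.

Lemma inner_scale_unit a x y : inner y y = 1 -> x = a *: y -> a = inner x y.
Proof. by move=> y1 ->; rewrite innerZl y1 mulr1. Qed.

Lemma norm_scale_unit a x y :
  inner x x = 1 -> inner y y = 1 -> x = a *: y -> `|a| = 1.
Proof.
move=> x1 y1 xE; apply/eqP; rewrite -(@pexpr_eq1 _ _ 2) //.
by rewrite -mul_conj_of -x1 xE innerZl innerZr y1 mulr1.
Qed.

End Inner.

(** * The form attached to a tensor *)

Section Form.
Variables (R : realType) (K : base_field) (n d : nat).
Local Notation F := (field_of R K).
Implicit Types (T : tensor F n d) (x : 'I_d -> 'cV[F]_n).

(** The arguments are conjugated so that an elementary tensor evaluates to a product of inner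
    products. *)
Definition tform T x : F :=
  \sum_(i : {ffun 'I_d -> 'I_n}) (T i : F) * \prod_j conj_of (x j (i j) 0).

Lemma tform_tprod v x : tform (tprod v) x = \prod_j inner (v j) (x j).
Proof.
rewrite /inner bigA_distr_bigA; apply: eq_bigr => i _.
by rewrite ffunE -big_split.
Qed.

Lemma tform_tcomb r (sigma : 'I_r -> F) v x :
  tform (tcomb sigma v) x = \sum_k sigma k * \prod_j inner (v k j) (x j).
Proof.
under [RHS]eq_bigr => k _ do rewrite -tform_tprod mulr_sumr.
rewrite exchange_big; apply: eq_bigr => i _ /=.
rewrite /tcomb sum_ffunE mulr_suml; apply: eq_bigr => k _.
by rewrite ffunE mulrA.
Qed.

Lemma tform_sym T (s : 'S_d) x : symmetric_tensor T ->
  tform T (fun j => x (s j)) = tform T x.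
Proof.
move=> Tsym; rewrite /tform.
rewrite (reindex (fun i : {ffun 'I_d -> 'I_n} => [ffun j => i (s j)])) /=;
  last first.
  exists (fun i : {ffun 'I_d -> 'I_n} => [ffun j => i (s^-1%g j)]) => i _;
    by apply/ffunP => j; rewrite !ffunE ?permK ?permKV.
apply: eq_bigr => i _; rewrite Tsym; congr (_ * _).
rewrite [RHS](reindex_inj (@perm_inj _ s)); apply: eq_bigr => j _.
by rewrite ffunE.
Qed.

Lemma sum_orthogonal r (sigma : 'I_r -> F) v x js k :
  orthogonal_at v js -> inner (v k js) (v k js) = 1 -> x js = v k js ->
  \sum_l sigma l * \prod_j inner (v l j) (x j)
    = sigma k * \prod_(j | j != js) inner (v k j) (x j).
Proof.
move=> vo vk1 xE; rewrite (bigD1 k) //= [X in _ + X]big1 ?addr0 => [|l lk].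
  by rewrite (bigD1 js) //= xE vk1 mul1r.
by rewrite (bigD1 js) //= xE vo ?mul0r ?mulr0 //; apply/eqP.
Qed.

End Form.

(** * Shortening an orthogonal decomposition *)

Section Reduction.
Variables (R : realType) (K : base_field) (n d : nat).
Local Notation F := (field_of R K).

(** Orthogonality is asked only away from [m], because after a merge the discarded vector need not
    be orthogonal to the merged one. *)
Lemma drop_zero_term (T : tensor F n d) r (sigma : 'I_r.+1 -> F) v js m :
  unit_decomposition T sigma v -> sigma m = 0 ->
  (forall k k', k != m -> k' != m -> k <> k' -> inner (v k js) (v k' js) = 0) ->
  orthogonal_length T r.
Proof.
move=> [v1 ->] sm0 vo.
exists (fun l => sigma (lift m l)), (fun l => v (lift m l)); split; last first.
  exists js => k k' kk'; apply: vo; rewrite 1?eq_sym ?neq_lift //.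
  by move/lift_inj.
by split=> //; rewrite /tcomb (bigD1_ord m) //= sm0 scale0r add0r.
Qed.

(** Off [js], term [m] has the factors of term [k] up to a total scalar [q], so the two terms add up
    to one elementary tensor with factor [w] at [js]. As a combination of [v k js] and [v m js], [w]
    stays orthogonal to the remaining factors there. *)
Lemma merge_terms (T : tensor F n d) r (sigma : 'I_r.+1 -> F) v js k m :
  unit_decomposition T sigma v -> orthogonal_at v js ->
  k != m -> sigma k != 0 ->
  (forall j, j != js -> v m j = inner (v m j) (v k j) *: v k j) ->
  orthogonal_length T r.
Proof.
move=> [v1 TE] vo km sk0 vE.
have inner1 l j : inner (v l j) (v l j) = 1.
  by apply/eqP; rewrite -vnorm_eq1 v1.
pose q := \prod_(j | j != js) inner (v m j) (v k j).
pose w := sigma k *: v k js + (sigma m * q) *: v m js.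
(* By orthogonality the squared norm is the sum of the squared moduli of the two coefficients, and
   [sigma k] is nonzero. *)
have w0 : inner w w != 0.
  rewrite innerDl !innerDr !innerZl !innerZr !inner1 !vo; last by apply/eqP.
    rewrite !mulr0 addr0 add0r !mulr1 !mul_conj_of.
    by rewrite gt_eqF // ltr_pwDl ?exprn_ge0 // exprn_gt0 // normr_gt0.
  by apply/eqP; rewrite eq_sym.
have [c c0 w1] := vnorm_normalize w0.
(* The weight [c^-1] undoes the normalization of [w]; term [m] stays with weight 0, to be removed by
   [drop_zero_term]. *)
pose sigma' l := if l == m then 0 else if l == k then c^-1 else sigma l.
pose v' l j := if (l == k) && (j == js) then c *: w else v l j.
apply: (@drop_zero_term T r sigma' v' js m).
- split=> [l j|]; first by rewrite /v'; case: ifP.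
  rewrite TE /tcomb (bigD1 m) // [RHS](bigD1 m) //=.
  rewrite (bigD1 k) // [in RHS](bigD1 k) //= !addrA; congr (_ + _); last first.
    apply: eq_bigr => l /andP[/negPf lm /negPf lk]; rewrite /sigma' lm lk.
    by congr (_ *: tprod _); rewrite /v' lk.
  rewrite /sigma' !eqxx (negPf km) scale0r add0r.
  apply/ffunP => i; rewrite !ffunE /GRing.scale /=.
  have prodE (u : 'I_d -> 'cV[F]_n) : \prod_j u j (i j) 0
      = u js (i js) 0 * \prod_(j | j != js) u j (i j) 0 by rewrite (bigD1 js).
  rewrite !prodE /v' !eqxx /= !mxE.
  have -> : \prod_(j | j != js) v m j (i j) 0
      = q * \prod_(j | j != js) v k j (i j) 0.
    rewrite -big_split; apply: eq_bigr => j jjs /=.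
    by rewrite {1}vE // mxE.
  under [in RHS]eq_bigr => j jjs do rewrite (negPf jjs).
  rewrite !mulrA mulVf // mul1r mulrDl addrC; congr (_ + _).
  by rewrite -!mulrA; congr (_ * _); rewrite mulrCA.
- by rewrite /sigma' eqxx.
move=> l l' lm l'm ll'; rewrite /v' eqxx !andbT.
have [lk|lk] := eqVneq l k; have [l'k|l'k] := eqVneq l' k.
- by case: ll'; rewrite lk l'k.
- rewrite innerZl innerDl !innerZl !vo ?mulr0 ?addr0 ?mulr0 //; apply/eqP.
    by rewrite eq_sym.
  by rewrite eq_sym.
- by rewrite innerZr innerDr !innerZr !vo ?mulr0 ?addr0 ?mulr0 //; apply/eqP.
by rewrite vo.
Qed.

End Reduction.

(** * Consequences of the symmetry of the tensor *)

Section SymmetricDecomposition.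
Variables (R : realType) (K : base_field) (n d r : nat).
Local Notation F := (field_of R K).
Variables (T : tensor F n d) (sigma : 'I_r -> F) (v : 'I_r -> 'I_d -> 'cV[F]_n).
Variable js : 'I_d.
Hypotheses (Tsym : symmetric_tensor T) (Tdec : unit_decomposition T sigma v).
Hypotheses (vorth : orthogonal_at v js) (sigma_neq0 : forall k, sigma k != 0).

Let inner1 k j : inner (v k j) (v k j) = 1.
Proof. by apply/eqP; rewrite -vnorm_eq1 (proj1 Tdec). Qed.

(** Before permuting, slot [js] holds [v k js] and isolates term [k]; afterwards it holds [v m js]
    and isolates term [m]. *)
Lemma symmetric_swap k m (s : 'S_d) (x : 'I_d -> 'cV[F]_n) :
  x js = v k js -> x (s js) = v m js ->
  sigma k * \prod_(j | j != js) inner (v k j) (x j)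
    = sigma m * \prod_(j | j != js) inner (v m j) (x (s j)).
Proof.
move=> xk xm; have [_ TE] := Tdec.
have := tform_sym s x Tsym; rewrite TE !tform_tcomb.
rewrite (sum_orthogonal _ vorth (inner1 _ _) xk).
by rewrite (@sum_orthogonal _ _ _ _ _ _ _ (fun j => x (s j)) js m).
Qed.

(** Swap [a] and [b] within the single term [k], with a free vector in slot [a] and the term's own
    unit factors elsewhere. *)
Lemma off_js_proportional k a b : a != js -> b != js ->
  v k a = inner (v k a) (v k b) *: v k b.
Proof.
move=> ajs bjs; have [<-|ab] := eqVneq a b; first by rewrite inner1 scale1r.
apply: inner_inj => y; rewrite innerZl.
pose x j := if j == a then y else v k j.
have xN j : j != a -> x j = v k j by rewrite /x => /negPf->.
have xa : x a = y by rewrite /x eqxx.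
have := @symmetric_swap k k (tperm a b) x.
rewrite tpermD // xN 1?eq_sym // => /(_ erefl erefl)/(mulfI (sigma_neq0 k)).
rewrite !(bigD1 a ajs) /= !(bigD1 b (P := fun j => (j != js) && (j != a))) /=;
  try by rewrite bjs eq_sym.
rewrite tpermL tpermR xa (xN b) 1?eq_sym // inner1 mul1r.
rewrite !big1 ?mulr1 // => j /andP[/andP[_ ja] jb]; last by rewrite xN ?inner1.
by rewrite tpermD 1?eq_sym // xN // inner1.
Qed.

(** Swap [js] and [a], holding [v k js] and [v m js], and leave slot [b] free. *)
Lemma off_js_parallel k m a b : a != js -> b != js -> a != b ->
  inner (v k a) (v m js) != 0 -> exists c, v k b = c *: v m b.
Proof.
move=> ajs bjs ab km0.
pose x z j := if j == js then v k js else if j == a then v m js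
              else if j == b then z else v k j.
pose s := tperm js a.
(* The quotient of the parts of the two sides that do not involve [z]; as slot [b] is excluded,
   [x 0] can stand for any [x z]. *)
exists (sigma m * (\prod_(j | (j != js) && (j != b)) inner (v m j) (x 0 (s j)))
        / (sigma k * inner (v k a) (v m js))).
apply: inner_inj => z; rewrite innerZl.
have := @symmetric_swap k m s (x z).
rewrite /s tpermL {1 2}/x (negPf ajs) !eqxx => /(_ erefl erefl).
rewrite (bigD1 a ajs) (bigD1 b (P := fun j => (j != js) && (j != a))) /=;
  last first.
  by rewrite bjs eq_sym.
rewrite [X in _ * (_ * X)]big1 => [|j /andP[/andP[jjs ja] jb]]; last first.
  by rewrite /x (negPf jjs) (negPf ja) (negPf jb) inner1.
rewrite mulr1 {1 2}/x (negPf ajs) (negPf bjs) (negPf ab) eq_sym (negPf ab) !eqxx.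
have sb : tperm js a b = b by rewrite tpermD // eq_sym.
rewrite (bigD1 b bjs) /= sb {1}/x (negPf bjs).
rewrite (eq_sym b) (negPf ab) eqxx.
rewrite (eq_bigr (fun j => inner (v m j) (x 0 (s j))))
  => [|j /andP[jjs jb]]; last first.
  have sjb : tperm js a j != b.
    by rewrite -(inj_eq (@perm_inj _ s)) tpermK sb.
  by rewrite /x (negPf sjb).
move=> E; apply: (mulfI (mulf_neq0 (sigma_neq0 k) km0)).
rewrite -[LHS]mulrA E [RHS]mulrA (mulrC (sigma k * _)) divfK ?mulf_neq0 //.
by rewrite -[RHS]mulrA (mulrC (inner _ z)).
Qed.

(** Swapping [js] and [a] moves [v k js] to slot [a], where the hypothesis kills every term but [k],
    while the free vector lands in slot [js]. *)
Lemma off_js_collinear k a : a != js ->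
  (forall m, m != k -> inner (v m a) (v k js) = 0) ->
  v k a = inner (v k a) (v k js) *: v k js.
Proof.
move=> ajs ma0; apply: inner_inj => y; rewrite innerZl.
pose x j := if j == js then v k js else if j == a then y else v k j.
have xjs : x js = v k js by rewrite /x eqxx.
have xa : x a = y by rewrite /x (negPf ajs) eqxx.
have [_ TE] := Tdec.
have := tform_sym (tperm js a) x Tsym; rewrite TE !tform_tcomb.
rewrite (sum_orthogonal _ vorth (inner1 _ _) xjs).
rewrite (bigD1 k) //= [X in _ + X]big1 ?addr0 => [|m mk]; last first.
  by rewrite (bigD1 a) //= tpermR xjs ma0 // mul0r mulr0.
move/(mulfI (sigma_neq0 k)).
rewrite (bigD1 js) //= tpermL xa (bigD1 a ajs) /= tpermR xjs.
rewrite [in RHS](bigD1 a ajs) /= xa.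
rewrite !big1 ?mulr1 => [<-|j /andP[jjs ja]|j /andP[jjs ja]].
- by rewrite mulrC.
- by rewrite /x (negPf jjs) (negPf ja) inner1.
by rewrite tpermD 1?eq_sym // /x (negPf jjs) (negPf ja) inner1.
Qed.

End SymmetricDecomposition.

Lemma dual_length_le (R : realType) (K : base_field) (n d r r' : nat)
    (sigma : 'I_r -> field_of R K) (v : 'I_r -> 'I_d -> 'cV[field_of R K]_n)
    (tau : 'I_r' -> field_of R K) (w : 'I_r' -> 'I_d -> 'cV[field_of R K]_n)
    (js jss : 'I_d) :
  (forall k j, inner (v k j) (v k j) = 1) -> (forall k, sigma k != 0) ->
  js != jss -> orthogonal_at v js -> orthogonal_at v jss ->
  tcomb sigma v = tcomb tau w -> (r <= r')%N.
Proof.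
move=> v1 sigma0 jsjss vjs vjss TE.
pose A : 'M_(r, r') := \matrix_(k, l) (tau l * inner (w l js) (v k js)).
pose B : 'M_(r', r) := \matrix_(l, m) \prod_(j | j != js) inner (w l j) (v m j).
have AB : A *m B = diag_mx (\row_k sigma k).
  apply/matrixP => k m; rewrite !mxE.
  pose x j := if j == js then v k js else v m j.
  have xjs : x js = v k js by rewrite /x eqxx.
  have xN j : j != js -> x j = v m j by rewrite /x => /negPf->.
  transitivity (tform (tcomb tau w) x).
    rewrite tform_tcomb; apply: eq_bigr => l _; rewrite !mxE -mulrA.
    rewrite (bigD1 js (P := predT)) //= xjs; congr (_ * (_ * _)).
    by apply: eq_bigr => j /xN->.
  rewrite -TE tform_tcomb (sum_orthogonal _ vjs (v1 _ _) xjs).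
  have [->|km] := eqVneq k m.
    rewrite mulr1n big1 ?mulr1 // => j jjs.
    by rewrite xN.
  (* Off the diagonal, the factor at the second orthogonal index vanishes. *)
  rewrite mulr0n (bigD1 jss) 1?eq_sym //= xN 1?eq_sym //.
  by rewrite vjss ?mul0r ?mulr0 //; apply/eqP.
have AB_unit : A *m B \in unitmx.
  rewrite AB unitmxE det_diag unitfE; apply/prodf_neq0 => k _.
  by rewrite mxE.
rewrite -(mxrank_unit AB_unit) (leq_trans (mxrankM_maxl _ _)) //.
exact: rank_leq_col.
Qed.

Theorem proposition4p3 (R : realType) (K : base_field) (n d : nat)
    (hd : (3 <= d)%N) (T : tensor (field_of R K) n d) (Tsym : symmetric_tensor T) :
  (forall (r : nat) (sigma : 'I_r -> field_of R K)
          (v : 'I_r -> 'I_d -> 'cV[field_of R K]_n) (js : 'I_d),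
     unit_decomposition T sigma v ->
     orthogonal_at v js ->
     least (orthogonal_length T) r ->
     forall (k : 'I_r) (j : 'I_d),
       exists c : field_of R K,
         `|c| = 1 /\ v k j = c *: v k (first_index hd))
  /\
  (forall (r : nat) (sigma : 'I_r -> field_of R K)
          (v : 'I_r -> 'I_d -> 'cV[field_of R K]_n) (js jss : 'I_d),
     unit_decomposition T sigma v ->
     (forall k, sigma k <> 0) ->
     js <> jss ->
     orthogonal_at v js ->
     orthogonal_at v jss ->
     least (orthogonal_length T) r /\ has_rank T r).
Proof.
split=> [r sigma v js Tdec vo [_ rmin] k j
        |r sigma v js jss [v1 TE] s0 /eqP jj vjs vjss].
  have vinner l i : inner (v l i) (v l i) = 1.
    by apply/eqP; rewrite -vnorm_eq1 (proj1 Tdec).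
  case: r => [|r] in sigma v Tdec vo rmin k vinner *; first by case: k.
  have no_shorter : ~ orthogonal_length T r by move/rmin; rewrite ltnn.
  have s0 l : sigma l != 0.
    apply/eqP => sl; apply: no_shorter.
    by apply: (drop_zero_term (js := js) Tdec sl) => p q _ _; apply: vo.
  have v_js l i : v l i = inner (v l i) (v l js) *: v l js.
    have [->|ijs] := eqVneq i js; first by rewrite vinner scale1r.
    apply: (off_js_collinear Tsym Tdec vo s0) => // m ml; apply/eqP/negPn/negP => im0.
    (* A third index exists because [d >= 3]. *)
    have [b bjs ib] : exists2 b : 'I_d, b != js & i != b.
      have : (0 < #|~: [set i; js]|)%N.
        rewrite -(ltn_add2l #|[set i; js]|) addn0 cardsC card_ord.
        by rewrite cards2 ijs.
      by case/card_gt0P => b; rewrite !inE negb_or eq_sym => /andP[]; exists b.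
    have [c cE] := off_js_parallel Tsym Tdec vo s0 ijs bjs ib im0.
    apply: no_shorter; apply: (@merge_terms _ _ _ _ _ _ _ _ js l m Tdec) => //.
      by rewrite eq_sym.
    (* Chain of multiples: [v m p], [v m b], [v l b], [v l p]. *)
    move=> p pjs; have vmp := off_js_proportional Tsym Tdec vo s0 m pjs bjs.
    have vlb := off_js_proportional Tsym Tdec vo s0 l bjs pjs.
    have vE := vmp; rewrite cE vlb !scalerA in vE.
    by rewrite {1}vE; congr (_ *: _); apply: inner_scale_unit vE.
  set o := first_index hd.
  have o0 : inner (v k o) (v k js) != 0.
    apply: contra_eq_neq (vinner k o) => o0.
    by rewrite {1}(v_js k o) o0 innerZl mul0r eq_sym oner_neq0.
  (* Both vectors are multiples of [v k js]; since both are unit vectors, the ratio of the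
     coefficients has modulus 1. *)
  have vE : v k j = (inner (v k j) (v k js) / inner (v k o) (v k js)) *: v k o.
    by rewrite [X in _ = _ *: X]v_js scalerA divfK // -v_js.
  by eexists; split; last exact: vE; exact: norm_scale_unit (vinner _ _) (vinner _ _) vE.
have {}s0 k : sigma k != 0 by apply/eqP.
have vinner k j : inner (v k j) (v k j) = 1.
  by apply/eqP; rewrite -vnorm_eq1 v1.
(* The competing decomposition is arbitrary, neither normalized nor orthogonal, so this bound serves
   both minimality claims. *)
have rmin r' : (exists tau w, T = @tcomb _ _ _ r' tau w) -> (r <= r')%N.
  by case=> tau [w]; rewrite TE; apply: dual_length_le jj vjs vjss.
split; split.
- by exists sigma, v; split; [|exists js].
- by move=> r' [tau [w [[_ Tw] _]]]; apply: rmin; exists tau, w.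
- by exists sigma, v.
exact: rmin.
Qed.
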